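(* Let $\mathbb{S}=\{S^i:i\in I\}$ be a market of nonnegative semimartingales and let $T\in(0,\infty)$. Let $(\mathcal{K}_\alpha)_{\alpha\geq0}$ be one of the families $$(\mathcal{I}_\alpha(\mathbb{S}))_{\alpha\geq0},\quad(\mathcal{I}^{\rm adm}_\alpha(\mathbb{S}))_{\alpha\geq0}.$$ If $\mathcal{K}_0$ satisfies NFLVR, then $\mathcal{K}_1$ satisfies NA$_1$.
   Context: Let $(\Omega,\mathcal{F},(\mathcal{F}_t)_{t\in\mathbb{R}_+},\mathbb{P})$ be a stochastic basis satisfying the usual conditions with $\mathcal{F}_0$ $\mathbb{P}$-trivial; processes are identified up to indistinguishability. $I\neq\emptyset$ is an arbitrary index set and $(S^i)_{i\in I}$ are real-valued semimartingales with $S^i\geq0$. For an $\mathbb{R}^d$-valued semimartingale $X$, $L(X)$ is the set of (predictable) $X$-integrable processes in the sense of vector stochastic integration and $\delta\bullet X$ the stochastic integral (with $(\delta\bullet X)_0=0$). A strategy for $\mathbb{S}$ is a process $\delta=(\delta^i)_{i\in I}$ such that $F:=\{i\in I:\delta^i\neq0\}$ is finite and $\delta^F=(\delta^i)_{i\in F}\in L(S^F)$, $S^F=(S^i)_{i\in F}$; $\Delta(\mathbb{S})$ is the set of strategies. Put $\delta\bullet S:=\delta^F\bullet S^F$ and $I^{\alpha,\delta}:=\alpha+\delta\bullet S$. A process $X$ is admissible if $X\geq-a$ for some constant $a\in\mathbb{R}_+$. For $\alpha\geq0$: $\mathbb{I}_\alpha(\mathbb{S}):=\{I^{\alpha,\delta}:\delta\in\Delta(\mathbb{S})\}$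 and $\mathbb{I}^{\rm adm}_\alpha(\mathbb{S})$ is its subset of admissible processes. $\mathcal{I}_\alpha(\mathbb{S}),\mathcal{I}^{\rm adm}_\alpha(\mathbb{S})$ consist of the terminal values $X_T$ of the processes $X$ in the corresponding set; they are subsets of $L^0=L^0(\Omega,\mathcal{F}_T,\mathbb{P})$ (a.s. equivalence classes, a.s. order). $\mathcal{K}_0$ satisfies NFLVR if $\overline{\mathcal{C}}\cap L^\infty_+=\{0\}$, where $\mathcal{C}:=(\mathcal{K}_0-L^0_+)\cap L^\infty$, $L^\infty=L^\infty(\Omega,\mathcal{F}_T,\mathbb{P})$, and the closure is taken in the $L^\infty$-norm. Let $\mathcal{B}:=(\mathcal{K}_1-L^0_+)\cap L^0_+$ and $p_{\mathcal{B}}(\xi):=\inf\{\alpha>0:\xi\in\alpha\mathcal{B}\}\in[0,\infty]$; $\mathcal{K}_1$ satisfies NA$_1$ if $p_{\mathcal{B}}(\xi)>0$ for all $\xi\in L^0_+\setminus\{0\}$. *)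

(* Defs.v *)
From HB Require Import structures.
From mathcomp Require Import all_boot all_order all_algebra.
From mathcomp Require Import all_classical all_reals all_analysis.

Set Implicit Arguments.
Unset Strict Implicit.
Unset Printing Implicit Defensive.

Import Order.TTheory GRing.Theory Num.Theory.
Import numFieldNormedType.Exports.

Local Open Scope classical_set_scope.
Local Open Scope ring_scope.

Section stochastic_basis.
Context {d : measure_display} {Omega : measurableType d} {R : realType}.
Variables (P : probability Omega R) (F : R -> set (set Omega)).

(* Time is [0, +oo[: processes and filtrations are indexed by the whole of R,
   but their values at negative times are never used. *)
Definition process : Type := R -> Omega -> R.

Definition measurable_wrt (G : set (set Omega)) (f : Omega -> R) : Prop :=
  measurable_fun [set: g_sigma_algebraType G] (f : g_sigma_algebraType G -> R).

(* Since [F t] only contains measurable sets, [usual_complete] also says that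
   P itself is complete. *)
Record usual_conditions : Prop := UsualConditions {
  usual_sigma_algebra : forall t : R, 0 <= t -> sigma_algebra [set: Omega] (F t) ;
  usual_sub : forall t : R, 0 <= t -> F t `<=` @measurable d Omega ;
  usual_nondecreasing : forall s t : R, 0 <= s -> s <= t -> F s `<=` F t ;
  usual_right_continuous : forall t : R, 0 <= t ->
    \bigcap_(s in [set s | t < s]) F s = F t ;
  usual_complete : forall t : R, 0 <= t -> negligible P `<=` F t }.

Definition trivial_sigma_algebra (G : set (set Omega)) : Prop :=
  forall A, G A -> P A = 0%E \/ P A = 1%E.

Definition indistinguishable (X Y : process) : Prop :=
  \forall w \ae P, forall t : R, 0 <= t -> X t w = Y t w.

Definition adapted (X : process) : Prop :=
  forall t : R, 0 <= t -> measurable_wrt (F t) (X t).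

Definition cadlag (X : process) : Prop :=
  forall (w : Omega) (t : R), 0 <= t ->
    (X s w @[s --> t^'+] --> X t w) /\ (0 < t -> cvg (X s w @[s --> t^'-])).

(** Semimartingales *)

Definition stopping_time (tau : Omega -> \bar R) : Prop :=
  (forall w, 0 <= tau w)%E /\
  forall t : R, 0 <= t -> F t [set w | (tau w <= t%:E)%E].

Definition stopped (X : process) (tau : Omega -> \bar R) : process :=
  fun t w => X (fine (mine t%:E (tau w))) w.

Definition martingale (M : process) : Prop :=
  [/\ adapted M, cadlag M,
      forall t : R, 0 <= t -> P.-integrable setT (EFin \o M t) &
      forall (s t : R) (A : set Omega), 0 <= s -> s <= t -> F s A ->
        (\int[P]_(w in A) (M t w)%:E = \int[P]_(w in A) (M s w)%:E)%E].

Definition local_martingale0 (M : process) : Prop :=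
  [/\ adapted M, cadlag M, (forall w, M 0 w = 0) &
      exists tau : nat -> Omega -> \bar R,
        [/\ forall n, stopping_time (tau n),
            \forall w \ae P, forall n, (tau n w <= tau n.+1 w)%E,
            \forall w \ae P, (tau n w @[n --> \oo] --> +oo)%E &
            forall n, martingale (stopped M (tau n))]].

Definition finite_variation0 (A : process) : Prop :=
  [/\ adapted A, cadlag A, (forall w, A 0 w = 0) &
      forall (w : Omega) (t : R), 0 <= t -> bounded_variation 0 t (A ^~ w)].

Definition semimartingale (X : process) : Prop :=
  [/\ adapted X, cadlag X &
      exists M A, [/\ local_martingale0 M, finite_variation0 A &
        indistinguishable X (fun t w => X 0 w + M t w + A t w)]].

(** Elementary predictable processes
      eta 1_{0} + \sum_k xi_k 1_{]s_k, t_k]}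
    and their stochastic integrals (null at time 0). *)

Record step := Step { step_lo : R ; step_hi : R ; step_coef : Omega -> R }.

Record elementary :=
  Elementary { elem_init : Omega -> R ; elem_steps : seq step }.

Definition bounded_wrt (G : set (set Omega)) (f : Omega -> R) : Prop :=
  measurable_wrt G f /\ exists M : R, forall w, `|f w| <= M.

Definition elem_predictable (K : elementary) : Prop :=
  bounded_wrt (F 0) (elem_init K) /\
  forall k, (k < size (elem_steps K))%N ->
    let st := nth (Step 0 0 (cst 0)) (elem_steps K) k in
    [/\ 0 <= step_lo st, step_lo st <= step_hi st &
        bounded_wrt (F (step_lo st)) (step_coef st)].

Definition elem_val (K : elementary) : process := fun t w =>
  (if t == 0 then elem_init K w else 0) +
  \sum_(st <- elem_steps K)
    (if (step_lo st < t) && (t <= step_hi st) then step_coef st w else 0).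

Definition elem_integral (K : elementary) (X : process) : process := fun t w =>
  \sum_(st <- elem_steps K) step_coef st w *
    (X (Num.min (step_hi st) t) w - X (Num.min (step_lo st) t) w).

Definition predictable_rectangles : set (set (R * Omega)) :=
  [set C | exists2 A, F 0 A & C = [set 0] `*` A] `|`
  [set C | exists (s t : R) (A : set Omega), [/\ 0 <= s, s <= t, F s A &
                             C = [set r | s < r /\ r <= t] `*` A]].

Definition predictable (H : process) : Prop :=
  measurable_fun
    ([set p | 0 <= p.1] : set (g_sigma_algebraType predictable_rectangles))
    (fun p => H p.1 p.2).

(** Vector stochastic integration *)

(* P (sup_{s <= t} |Y_s| > e) *)
Definition exceedance (Y : process) (t e : R) : \bar R :=
  P [set w | exists2 s : R, 0 <= s <= t & e < `|Y s w|].

Definition ucp_cvg (Y_ : nat -> process) (Y : process) : Prop :=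
  forall t e : R, 0 <= t -> 0 < e ->
    exceedance (fun s w => Y_ n s w - Y s w) t e @[n --> \oo] --> 0%E.

(* [bounded_integral X H Y]: H is a bounded predictable R^n-valued process and
   Y is its stochastic integral with respect to X. The integral of bounded
   predictable processes is the unique extension of the elementary integral
   that is continuous, for the u.c.p. topology, along uniformly bounded
   pointwise convergent sequences; its graph (up to indistinguishability) is
   therefore the closure of the elementary graph under such limits. *)
Inductive bounded_integral (n : nat) (X : 'I_n -> process) :
    ('I_n -> process) -> process -> Prop :=
| bounded_integral_elem (K : 'I_n -> elementary) :
    (forall j, elem_predictable (K j)) ->
    bounded_integral X (fun j => elem_val (K j))
      (fun t w => \sum_(j < n) elem_integral (K j) (X j) t w)
| bounded_integral_lim (H_ : nat -> 'I_n -> process) (H : 'I_n -> process)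
    (Y_ : nat -> process) (Y : process) (M : R) :
    (forall m, bounded_integral X (H_ m) (Y_ m)) ->
    (forall m j (t : R) w, 0 <= t -> `|H_ m j t w| <= M) ->
    (forall j (t : R) w, 0 <= t -> H_ m j t w @[m --> \oo] --> H j t w) ->
    adapted Y -> cadlag Y -> ucp_cvg Y_ Y ->
    bounded_integral X H Y.

(* Convergence in Emery's semimartingale topology, as c --> +oo, of processes
   null at time 0: sup_K P (sup_{s <= t} |(K . (Z c - Y))_s| > e) --> 0, where
   K ranges over the elementary predictable processes bounded by 1. *)
Definition emery_cvg (Z : R -> process) (Y : process) : Prop :=
  forall t e eta : R, 0 <= t -> 0 < e -> 0 < eta ->
    \forall c \near +oo, forall K, elem_predictable K ->
      (forall (s : R) w, 0 <= s -> `|elem_val K s w| <= 1) ->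
      (exceedance (elem_integral K (fun s w => (Z c s w - Y s w)%R)) t e
         <= eta%:E)%E.

(* H 1_{|H| <= c}, with |.| the Euclidean norm *)
Definition truncate (n : nat) (c : R) (H : 'I_n -> process) : 'I_n -> process :=
  fun j t w =>
    if Num.sqrt (\sum_(k < n) H k t w ^+ 2) <= c then H j t w else 0.

(* [stochastic_integral X H Y]: H is in L(X) and Y is (a version of) its vector
   stochastic integral with respect to the R^n-valued semimartingale X, that is,
   the limit in the semimartingale topology of the integrals of H 1_{|H| <= c}
   (Chou, Meyer and Stricker; Memin). Only the whole vector H is truncated:
   its components need not be integrable one by one. *)
Definition stochastic_integral (n : nat) (X H : 'I_n -> process) (Y : process)
    : Prop :=
  [/\ forall j, predictable (H j), adapted Y, cadlag Y, (forall w, Y 0 w = 0) &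
      exists Z : R -> process,
        (forall c : R, 0 < c -> bounded_integral X (truncate c H) (Z c)) /\
        emery_cvg Z Y].

(** Markets *)

Section market.
Context {I : Type}.
Variable S : I -> process.

Definition active (delta : I -> process) : set I :=
  [set i | ~ indistinguishable (delta i) (fun _ _ => 0)].

(* delta is a strategy and Y = delta . S. The map f enumerates the finite set
   [active delta]; the order of enumeration is immaterial. *)
Definition strategy_integral (delta : I -> process) (Y : process) : Prop :=
  exists n (f : 'I_n -> I),
    [/\ injective f, range f = active delta &
        stochastic_integral (fun k => S (f k)) (fun k => delta (f k)) Y].

Definition investments (alpha : R) : set process :=
  [set X | exists delta Y, strategy_integral delta Y /\
           indistinguishable X (fun t w => alpha + Y t w)].

Definition admissible (X : process) : Prop :=
  exists a : R, 0 <= a /\ \forall w \ae P, forall t : R, 0 <= t -> - a <= X t w.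

Definition adm_investments (alpha : R) : set process :=
  investments alpha `&` admissible.

End market.

(** Subsets of L^0(Omega, G, P). A set of classes of random variables is
    represented by the set of all representatives of its elements. *)

Section random_variables.
Variable G : set (set Omega).

Definition L0 : set (Omega -> R) := measurable_wrt G.

Definition L0_plus : set (Omega -> R) :=
  L0 `&` [set xi | \forall w \ae P, 0 <= xi w].

Definition L0_zero : set (Omega -> R) :=
  L0 `&` [set xi | xi = cst 0 %[ae P]].

Definition Linfty : set (Omega -> R) :=
  L0 `&` [set xi | (Lnorm P +oo (EFin \o xi) < +oo)%E].

Definition Linfty_plus : set (Omega -> R) := Linfty `&` L0_plus.

Definition Linfty_closure (C : set (Omega -> R)) : set (Omega -> R) :=
  Linfty `&` [set xi | forall e : R, 0 < e ->
    exists2 zeta, C zeta & (Lnorm P +oo (EFin \o (xi \- zeta)%R) < e%:E)%E].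

Definition minus_L0_plus (K : set (Omega -> R)) : set (Omega -> R) :=
  [set xi | exists k l, [/\ K k, L0_plus l & xi = k \- l]].

Definition NFLVR (K0 : set (Omega -> R)) : Prop :=
  let C := minus_L0_plus K0 `&` Linfty in
  Linfty_closure C `&` Linfty_plus = L0_zero.

Definition gauge (B : set (Omega -> R)) (xi : Omega -> R) : \bar R :=
  ereal_inf [set alpha%:E | alpha in
    [set alpha : R | 0 < alpha /\
                     exists2 b, B b & xi = (fun w => alpha * b w)]].

Definition NA1 (K1 : set (Omega -> R)) : Prop :=
  let B := minus_L0_plus K1 `&` L0_plus in
  forall xi, L0_plus xi -> ~ L0_zero xi -> (0 < gauge B xi)%E.

End random_variables.

Definition terminal_values (T : R) (XX : set process) : set (Omega -> R) :=
  L0 (F T) `&` [set xi | exists2 X, XX X & xi = X T %[ae P]].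

End stochastic_basis.

Arguments process {d} Omega R.

(* Main.v *)
Require Import Defs.
From mathcomp Require Import all_boot all_order all_algebra.
From mathcomp Require Import all_classical all_reals all_analysis.
From mathcomp Require Import measurable_realfun ess_sup_inf lra.

Set Implicit Arguments.
Unset Strict Implicit.
Unset Printing Implicit Defensive.

Import Order.TTheory GRing.Theory Num.Theory.
Import numFieldNormedType.Exports.

Local Open Scope classical_set_scope.
Local Open Scope ring_scope.

(** If NA_1 fails, there is a nonzero [xi] in L^0_+ such that for arbitrarily
    small [alpha > 0] some [k] in K_1 satisfies [xi <= alpha * k]. Strategies may
    be multiplied by [alpha], so [alpha * k - alpha] belongs to K_0 and dominates
    [min xi 1 - alpha], which is therefore in C. Letting [alpha] tend to 0, the
    nonzero element [min xi 1] of L^oo_+ is in the closure of C, which contradicts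
    NFLVR. *)

(** * Measurability with respect to a sub-collection of events *)

Section measurable_wrt.
Context {R : realType} {d : measure_display} {Omega : measurableType d}.
Variable G : set (set Omega).
Implicit Types f g : Omega -> R.

Lemma measurable_wrt_cst (a : R) : measurable_wrt G (cst a).
Proof. exact: measurable_cst. Qed.

Lemma measurable_wrtM f g :
  measurable_wrt G f -> measurable_wrt G g -> measurable_wrt G (f \* g).
Proof. exact: measurable_funM. Qed.

Lemma measurable_wrtZ (a : R) f :
  measurable_wrt G f -> measurable_wrt G (fun w => a * f w).
Proof. by move=> mf; apply: measurable_wrtM => //; exact: measurable_wrt_cst. Qed.

Lemma measurable_wrtB f g :
  measurable_wrt G f -> measurable_wrt G g -> measurable_wrt G (f \- g).
Proof. exact: measurable_funB. Qed.

Lemma measurable_wrtBcst f (a : R) :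
  measurable_wrt G f -> measurable_wrt G (fun w => f w - a).
Proof. by move=> mf; apply: measurable_wrtB => //; exact: measurable_wrt_cst. Qed.

Lemma measurable_wrt_min1 f :
  measurable_wrt G f -> measurable_wrt G (fun w => Num.min (f w) 1).
Proof.
by move=> mf; apply: measurable_minr => //; exact: measurable_wrt_cst.
Qed.

End measurable_wrt.

Lemma Lnorm_pinfty_le {d : measure_display} {T : measurableType d}
    {R : realType} (mu : {measure set T -> \bar R}) (f : T -> R) (r : R) :
  0 <= r -> (\forall x \ae mu, `|f x| <= r) ->
  (Lnorm mu +oo (EFin \o f) <= r%:E)%E.
Proof.
(* The sup norm is defined by cases: in the degenerate case it is 0 and [r0] suffices, otherwise it
   is an essential supremum. *)
move=> r0 fr; rewrite unlock; case: ifPn => // _.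
by apply/ess_supP; apply: filterS fr => x; rewrite /= lee_fin.
Qed.

(** * Homogeneity of the stochastic integral in its integrand *)

Section scaling.
Context {R : realType} {d : measure_display} {Omega : measurableType d}.
Variables (P : probability Omega R) (F : R -> set (set Omega)).
Implicit Types (X Y : process Omega R).

Definition scale_process (a : R) X : process Omega R := fun t w => a * X t w.

Lemma adapted_scale (a : R) Y : adapted F Y -> adapted F (scale_process a Y).
Proof. by move=> aY t t0; apply: measurable_wrtZ; exact: aY. Qed.

Lemma cadlag_scale (a : R) Y : cadlag Y -> cadlag (scale_process a Y).
Proof.
move=> cY w t t0; have [rc lc] := cY w t t0; split; first exact: cvgMl_tmp.
by move=> /lc; exact: is_cvgMl_tmp.
Qed.

Lemma indistinguishable_scale (a : R) X Y : indistinguishable P X Y ->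
  indistinguishable P (scale_process a X) (scale_process a Y).
Proof. by apply: filterS => w XY t t0; rewrite /scale_process XY. Qed.

Lemma predictable_scale (a : R) X :
  predictable F X -> predictable F (scale_process a X).
Proof. by move=> pX; apply: measurable_funM => //; exact: measurable_cst. Qed.

(** Both u.c.p. and Emery convergence quantify over all thresholds, so absorbing the factor into the
    threshold transfers them to multiples. *)
Lemma exceedance_scale (a : R) Y (t e : R) : 0 < a ->
  exceedance P (scale_process a Y) t e = exceedance P Y t (e / a).
Proof.
move=> a0; rewrite /exceedance; congr (P _).
have ea s w : (e < `|scale_process a Y s w|) = (e / a < `|Y s w|).
  by rewrite normrM gtr0_norm// ltr_pdivrMr// mulrC.
by apply/seteqP; split=> w [s st h]; exists s => //; rewrite ?ea// -ea.
Qed.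

Lemma ucp_cvg_scale (a : R) (Y_ : nat -> process Omega R) Y : 0 < a ->
  ucp_cvg P Y_ Y ->
  ucp_cvg P (fun n => scale_process a (Y_ n)) (scale_process a Y).
Proof.
move=> a0 YY t e t0 e0.
rewrite (_ : (fun n => _) =
    (fun n => exceedance P (fun s w => Y_ n s w - Y s w) t (e / a))).
  by apply: YY => //; exact: divr_gt0.
apply/funext => n; rewrite -exceedance_scale//; congr exceedance.
by apply/funext => s; apply/funext => w; rewrite /scale_process mulrBr.
Qed.

Definition scale_step (a : R) (st : @step _ Omega R) : @step _ Omega R :=
  Step (step_lo st) (step_hi st) (fun w => a * step_coef st w).

Definition scale_elementary (a : R) (K : @elementary _ Omega R) : @elementary _ Omega R :=
  Elementary (fun w : Omega => a * elem_init K w)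
    (map (scale_step a) (elem_steps K)).

Lemma bounded_wrt_scale (a : R) (G : set (set Omega)) (f : Omega -> R) :
  bounded_wrt G f -> bounded_wrt G (fun w => a * f w).
Proof.
move=> [mf [M fM]]; split; first exact: measurable_wrtZ.
by exists (`|a| * M) => w; rewrite normrM ler_wpM2l.
Qed.

Lemma elem_predictable_scale (a : R) (K : @elementary _ Omega R) :
  elem_predictable F K -> elem_predictable F (scale_elementary a K).
Proof.
move=> [iK sK]; split=> /=; first exact: bounded_wrt_scale.
move=> k; rewrite size_map => kK.
rewrite (nth_map (Step 0 0 (cst 0)))//=.
by have [? ? ?] := sK k kK; split => //; exact: bounded_wrt_scale.
Qed.

Lemma elem_val_scale (a : R) (K : @elementary _ Omega R) :
  elem_val (scale_elementary a K) = scale_process a (elem_val K).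
Proof.
apply/funext => t; apply/funext => w.
rewrite /elem_val /scale_process big_map mulrDr mulr_sumr; congr (_ + _).
  by case: ifP => // _; rewrite mulr0.
by apply: eq_bigr => st _ /=; case: ifP => // _; rewrite mulr0.
Qed.

Lemma elem_integral_scale (a : R) (K : @elementary _ Omega R) X :
  elem_integral (scale_elementary a K) X = scale_process a (elem_integral K X).
Proof.
apply/funext => t; apply/funext => w.
rewrite /elem_integral /scale_process big_map mulr_sumr.
by apply: eq_bigr => st _ /=; rewrite mulrA.
Qed.

(** In Emery's topology the test integrand [K] is bounded by 1 and must not be rescaled, so there
    the factor sits on the integrator. *)
Lemma elem_integral_scaler (a : R) (K : @elementary _ Omega R) X :
  elem_integral K (scale_process a X) = scale_process a (elem_integral K X).
Proof.
apply/funext => t; apply/funext => w.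
rewrite /elem_integral /scale_process mulr_sumr.
by apply: eq_bigr => st _; rewrite -mulrBr mulrCA.
Qed.

(** Induction on the closure that defines the integral: elementary integrands are scaled coefficient
    by coefficient, and the limits taken remain uniformly bounded, with [a * M] in place of [M]. *)
Lemma bounded_integral_scale (a : R) (n : nat) (X H : 'I_n -> process Omega R) Y :
  0 < a -> bounded_integral P F X H Y ->
  bounded_integral P F X (fun j => scale_process a (H j)) (scale_process a Y).
Proof.
move=> a0; elim=> {H Y} [K pK|H_ H Y_ Y M _ IH HM HH aY cY YY].
  have := bounded_integral_elem P (K := fun j => scale_elementary a (K j)) X
    (fun j => elem_predictable_scale a (pK j)).
  congr (bounded_integral P F X _ _).
    by apply/funext => j; exact: elem_val_scale.
  apply/funext => t; apply/funext => w; rewrite /scale_process mulr_sumr.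
  by apply: eq_bigr => j _; rewrite elem_integral_scale.
apply: (bounded_integral_lim (M := a * M) IH).
- by move=> m j t w t0; rewrite normrM gtr0_norm// ler_pM2l// HM.
- by move=> j t w t0; apply: cvgMl_tmp; exact: HH.
- exact: adapted_scale.
- exact: cadlag_scale.
- exact: ucp_cvg_scale.
Qed.

(** The index [c / a] is the level at which [H] is truncated when [a * H] is truncated at [c]; it
    still tends to infinity with [c]. *)
Lemma emery_cvg_scale (a : R) (Z : R -> process Omega R) Y : 0 < a ->
  emery_cvg P F Z Y ->
  emery_cvg P F (fun c => scale_process a (Z (c / a))) (scale_process a Y).
Proof.
move=> a0 ZY t e eta t0 e0 eta0.
have [c [cR cP]] := ZY t (e / a) eta t0 (divr_gt0 e0 a0) eta0.
(* Beyond [c * a], the rescaled index [x / a] exceeds [c]. *)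
exists (c * a); split; first exact: num_real.
move=> x cx K pK K1; rewrite -ltr_pdivlMr// in cx.
have := cP _ cx K pK K1; rewrite -exceedance_scale// -elem_integral_scaler.
congr (exceedance _ (elem_integral _ _) _ _ <= _)%E.
by apply/funext => s; apply/funext => w; rewrite /scale_process mulrBr.
Qed.

(** The Euclidean norm is positively homogeneous, so [a * H] has norm at most [c] exactly where [H]
    has norm at most [c / a]. *)
Lemma truncate_scale (a c : R) (n : nat) (H : 'I_n -> process Omega R) : 0 < a ->
  truncate c (fun j => scale_process a (H j)) =
  (fun j => scale_process a (truncate (c / a) H j)).
Proof.
move=> a0; apply/funext => j; apply/funext => t; apply/funext => w.
rewrite /truncate /scale_process.
under eq_bigr do rewrite exprMn.
rewrite -mulr_sumr sqrtrM ?sqr_ge0// sqrtr_sqr gtr0_norm//.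
by rewrite ler_pdivlMr// mulrC; case: ifP => // _; rewrite mulr0.
Qed.

Lemma stochastic_integral_scale (a : R) (n : nat)
    (X H : 'I_n -> process Omega R) Y :
  0 < a -> stochastic_integral P F X H Y ->
  stochastic_integral P F X (fun j => scale_process a (H j)) (scale_process a Y).
Proof.
move=> a0 [pH aY cY Y0 [Z [ZH ZY]]]; split.
- by move=> j; exact: predictable_scale.
- exact: adapted_scale.
- exact: cadlag_scale.
- by move=> w; rewrite /scale_process Y0 mulr0.
exists (fun c => scale_process a (Z (c / a))); split; last exact: emery_cvg_scale.
move=> c c0; rewrite truncate_scale//; apply: bounded_integral_scale => //.
by apply: ZH; exact: divr_gt0.
Qed.

(** * Strategies, investments and terminal values under affine maps *)

Context {I : Type}.
Variable S : I -> process Omega R.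

(** A strategy comes with an enumeration of exactly its active set; this lets the multiple keep the
    same enumeration. *)
Lemma active_scale (a : R) (delta : I -> process Omega R) : a != 0 ->
  active P (fun i => scale_process a (delta i)) = active P delta.
Proof.
move=> a0; apply/funext => i; apply/propext; rewrite /active/=.
split; apply: contra_not; apply: filterS => w h t t0.
  by rewrite /scale_process h// mulr0.
by have /eqP := h t t0; rewrite mulf_eq0 (negbTE a0) => /eqP.
Qed.

Lemma strategy_integral_scale (a : R) (delta : I -> process Omega R) Y : 0 < a ->
  strategy_integral P F S delta Y ->
  strategy_integral P F S (fun i => scale_process a (delta i))
    (scale_process a Y).
Proof.
move=> a0 [n [f [f_inj f_range int]]]; exists n, f; split => //.
  by rewrite active_scale// gt_eqF.
exact: stochastic_integral_scale.
Qed.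

(** If [X] is [x + Y], then [y + a * Y] is [a * X + (y - a * x)]: the gains are scaled by scaling
    the strategy, while the initial capital can be chosen freely. *)
Lemma investments_scale (a x y : R) X : 0 < a -> investments P F S x X ->
  investments P F S y (fun t w => a * X t w + (y - a * x)).
Proof.
move=> a0 [delta [Y [intY XY]]].
exists (fun i => scale_process a (delta i)), (scale_process a Y).
split; first exact: strategy_integral_scale.
by apply: filterS XY => w XY t t0; rewrite XY// /scale_process mulrDr; lra.
Qed.

Lemma admissible_affine (a b : R) X : 0 < a -> admissible P X ->
  admissible P (fun t w => a * X t w + b).
Proof.
move=> a0 [m [m0 Xm]]; exists (a * m + `|b|); split.
  by rewrite addr_ge0// mulr_ge0// ltW.
apply: filterS Xm => w Xm t t0.
by rewrite opprD -mulrN lerD ?ler_pM2l ?Xm// lerNl -normrN ler_norm.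
Qed.

Lemma terminal_values_scale (T a b : R) (XX YY : set (process Omega R)) :
  0 <= T -> (forall X, XX X -> YY (fun t w => a * X t w + b)) ->
  forall xi, terminal_values P F T XX xi ->
    terminal_values P F T YY (fun w => a * xi w + b).
Proof.
move=> T0 XY xi [mxi [X XX_X xiX]]; split.
  have := measurable_wrtBcst (- b) (measurable_wrtZ a mxi).
  by congr measurable_wrt; apply/funext => w; rewrite opprK.
exists (fun t w => a * X t w + b); first exact: XY.
by apply: filterS xiX => w /= h _; rewrite h.
Qed.

End scaling.

(** * From NFLVR to NA_1 for abstract sets of terminal values *)

Section no_arbitrage.
Context {R : realType} {d : measure_display} {Omega : measurableType d}.
Variables (P : probability Omega R) (G : set (set Omega)).

Lemma gauge_le0_small (B : set (Omega -> R)) (xi : Omega -> R) :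
  ~ (0 < gauge B xi)%E -> forall e : R, 0 < e ->
  exists alpha, [/\ 0 < alpha, alpha < e &
    exists2 b, B b & xi = (fun w => alpha * b w)].
Proof.
move=> /negP; rewrite -leNgt => g0 e e0.
have /ereal_inf_lt[_ [alpha [a0 ab]] <-] : (gauge B xi < e%:E)%E.
  by rewrite (le_lt_trans g0)// lte_fin.
by rewrite lte_fin => ae; exists alpha.
Qed.

Lemma min1_Linfty_plus (xi : Omega -> R) : L0_plus P G xi ->
  Linfty_plus P G (fun w => Num.min (xi w) 1).
Proof.
move=> [mxi xi0]; have mmin := measurable_wrt_min1 mxi.
have min0 : \forall w \ae P, 0 <= Num.min (xi w) 1.
  by apply: filterS xi0 => w h; rewrite le_min h ler01.
split; last by split.
split => //=; apply: (@le_lt_trans _ _ 1%:E); last exact: ltry.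
apply: Lnorm_pinfty_le => //.
by apply: filterS min0 => w h; rewrite ger0_norm// ge_min lexx orbT.
Qed.

Lemma min1_sub_Linfty (xi : Omega -> R) (alpha : R) : L0_plus P G xi ->
  0 <= alpha -> Linfty P G (fun w => Num.min (xi w) 1 - alpha).
Proof.
move=> [mxi xi0] a0; split.
  exact: measurable_wrtBcst (measurable_wrt_min1 mxi).
apply: (@le_lt_trans _ _ (1 + alpha)%:E); last exact: ltry.
apply: Lnorm_pinfty_le; first by rewrite addr_ge0.
apply: filterS xi0 => w h; rewrite (le_trans (ler_normB _ _))//.
rewrite (ger0_norm a0) lerD2r ger0_norm ?ge_min ?lexx ?orbT//.
by rewrite le_min h ler01.
Qed.

(** The market enters only through the map from [K1] to [K0] that scales by [alpha] and removes the
    initial capital [alpha]; the rest uses order and the sup norm. *)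
Lemma NFLVR_NA1 (K0 K1 : set (Omega -> R)) :
  K1 `<=` L0 G ->
  (forall (alpha : R) k, 0 < alpha -> K1 k -> K0 (fun w => alpha * k w - alpha)) ->
  NFLVR P G K0 -> NA1 P G K1.
Proof.
move=> K1_L0 K10 nflvr B xi xi_ge0 xi_neq0.
have [//|/gauge_le0_small small] := pselect (0 < gauge B xi)%E.
exfalso; apply: xi_neq0.
pose m w := Num.min (xi w) 1.
have : L0_zero P G m; last first.
  move=> [_ m0]; split; first by case: xi_ge0.
  (* Capping at 1 makes [xi] bounded without creating zeros: where the minimum is 0 it cannot be the
     value 1, so it is [xi] itself. *)
  apply: filterS m0 => w /= h /h; rewrite /m minEle /cst.
  by case: ifP => // _ /eqP; rewrite oner_eq0.
rewrite -nflvr; split; last exact: min1_Linfty_plus.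
split; first by have [] := min1_Linfty_plus xi_ge0.
move=> e e0; have [alpha [a0 ae [b [[k [l [K1k l_ge0 bE]]] b_ge0] xiE]]] := small e e0.
(* This approximant differs from [m] by the constant [alpha], which is below [e]. *)
exists (fun w => m w - alpha); last first.
  apply: (@le_lt_trans _ _ alpha%:E); last by rewrite lte_fin.
  apply: Lnorm_pinfty_le; first exact: ltW.
  by apply: nearW => w /=; rewrite opprB addrC subrK gtr0_norm.
split; last exact: min1_sub_Linfty (ltW a0).
have [mxi _] := xi_ge0; have [_ l0] := l_ge0.
(* The second witness is the surplus of the [K0] payoff over [m - alpha]. It is nonnegative almost
   surely because [alpha * k] equals [xi + alpha * l], which dominates [xi] and hence [m]. *)
exists (fun w => alpha * k w - alpha), (fun w => alpha * k w - m w); split.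
- exact: K10.
- split.
    apply: measurable_wrtB; last exact: measurable_wrt_min1.
    by apply: measurable_wrtZ; exact: K1_L0.
  apply: filterS l0 => w l0; have -> : alpha * k w = xi w + alpha * l w.
    by rewrite xiE bE /= -mulrDr subrK.
  by rewrite subr_ge0 /m ge_min lerDl mulr_ge0// ltW.
- by apply/funext => w /=; lra.
Qed.

End no_arbitrage.

Theorem proposition7p27 (R : realType) (d : measure_display)
  (Omega : measurableType d) (P : probability Omega R)
  (F : R -> set (set Omega)) (F_usual : usual_conditions P F)
  (F0_trivial : trivial_sigma_algebra P (F 0))
  (I : Type) (I_inhabited : inhabited I) (S : I -> process Omega R)
  (S_semimartingale : forall i, semimartingale P F (S i))
  (S_ge0 : forall i, \forall w \ae P, forall t : R, 0 <= t -> 0 <= S i t w)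
  (T : R) (T_gt0 : 0 < T)
  (K : R -> set (Omega -> R))
  (K_def : K = (fun alpha => terminal_values P F T (investments P F S alpha)) \/
           K = (fun alpha =>
                  terminal_values P F T (adm_investments P F S alpha))) :
  NFLVR P (F T) (K 0) -> NA1 P (F T) (K 1).
Proof.
have T_ge0 := ltW T_gt0.
(* Both families are handled by passing from capital 1 to capital 0, where the shift [0 - alpha * 1]
   is the required [- alpha]; the second also needs admissibility to survive this affine map. *)
case: K_def => ->; apply: NFLVR_NA1 => [k [mk _] //|alpha k a0].
  apply: terminal_values_scale => // X /(investments_scale 0 a0).
  by rewrite sub0r mulr1.
apply: terminal_values_scale => // X [invX admX]; split.
  by have := investments_scale 0 a0 invX; rewrite sub0r mulr1.
exact: admissible_affine.
Qed.
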